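(* For binary (additive, not necessarily symmetric) valuations, there is no algorithm which is EF1-over-rounds and also chooses a maximum weight matching for each time step, even for non-dynamic valuations. That is, there exist finite sets $N,M$ with $|N|=|M|$, a number $a\in[0,1)$, and non-dynamic (time-independent) additive valuations with $v_i(j)\in\{a,1\}$ for all $i,j$ on opposite sides, such that there is no sequence $x^1,x^2,\dots$ of perfect matchings between $N$ and $M$ for which every $x^t$ is a maximum weight matching and the cumulative matching $X^t$ is EF1 for every $t\ge 0$.
   Context: Setting. $N$ and $M$ are disjoint finite sets of agents (the two sides of the market), $|N|=|M|$. At each time step $t=1,2,\dots$ a perfect matching $x^t$ between $N$ and $M$ is chosen. The cumulative matching $X^t$ assigns to each agent $i$ the multiset $X_i^t$ of agents matched to $i$ at times $1,\dots,t$ (with multiplicity); $X_i^0=\emptyset$. Additive valuations. Each agent $i$ has a value $v_i(j)$ for each agent $j$ on the opposite side, and $v_i(Y)=\sum_{j\in Y}v_i(j)$ for a multiset $Y$ (counted with multiplicity). Envy and EF1. For $i,j$ on the same side, $i$ envies $j$ under $X$ if $v_i(X_i)<v_i(X_j)$. $X$ is EF1 if whenever $i$ envies $j$ there is $k\in X_j$ such that $v_i(X_i)\ge v_i(X_j\setminus\{k\})$ (one occurrence of $k$ is removed). Weight. The weight of a perfect matching $x$ is $\frac12\sum_{\{i,j\}\in x}(v_i(j)+v_j(i))$; a maximum weight matching is a perfect matching of maximum weight. An algorithm is EF1-over-rounds if for every instance it produces a sequence of perfect matchings $x^1,x^2,\dots$ with $X^t$ EF1 for all $t\ge0$. *)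

(* Defs.v *)
From mathcomp Require Import all_boot all_order all_algebra.
From mathcomp Require Import finmap multiset.

Set Implicit Arguments.
Unset Strict Implicit.
Unset Printing Implicit Defensive.

Import Order.TTheory GRing.Theory Num.Theory.
Local Open Scope mset_scope.
Local Open Scope ring_scope.

(* The two sides of the market are two finite types N and M.  A matching is a
   set of edges, that is, of pairs in N * M. *)

Definition partnersN (N M : finType) (x : {set N * M}) (i : N) : {set M} :=
  [set j | (i, j) \in x].

Definition partnersM (N M : finType) (x : {set N * M}) (j : M) : {set N} :=
  [set i | (i, j) \in x].

Definition perfect_matching (N M : finType) (x : {set N * M}) : Prop :=
  (forall i, #|partnersN x i| = 1%N) /\ (forall j, #|partnersM x j| = 1%N).

Definition weight (R : realFieldType) (N M : finType)
    (vN : N -> M -> R) (vM : M -> N -> R) (x : {set N * M}) : R :=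
  2^-1 * \sum_(e in x) (vN e.1 e.2 + vM e.2 e.1).

Definition max_weight_matching (R : realFieldType) (N M : finType)
    (vN : N -> M -> R) (vM : M -> N -> R) (x : {set N * M}) : Prop :=
  perfect_matching x /\
  forall y : {set N * M}, perfect_matching y ->
    weight vN vM y <= weight vN vM x.

(* [p t] is the set of partners of a fixed agent at time t; times start at 1,
   so [p 0] is never used. *)
Fixpoint cumul (T : finType) (p : nat -> {set T}) (t : nat) : {mset T} :=
  if t is s.+1 then cumul p s `+` seq_mset (enum (p s.+1)) else mset0.

Definition cumulN (N M : finType) (x : nat -> {set N * M}) (t : nat) (i : N) :
    {mset M} := cumul (fun s => partnersN (x s) i) t.

Definition cumulM (N M : finType) (x : nat -> {set N * M}) (t : nat) (j : M) :
    {mset N} := cumul (fun s => partnersM (x s) j) t.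

(* Sum over the enumeration of Y with repetitions. *)
Definition value (R : realFieldType) (T : finType) (v : T -> R) (Y : {mset T})
  : R := \sum_(j <- Y) v j.

Definition envies (R : realFieldType) (A B : finType) (v : A -> B -> R)
    (X : A -> {mset B}) (i j : A) : Prop :=
  value (v i) (X i) < value (v i) (X j).

Definition EF1_side (R : realFieldType) (A B : finType) (v : A -> B -> R)
    (X : A -> {mset B}) : Prop :=
  forall i j : A, envies v X i j ->
    exists2 k : B, k \in X j & value (v i) (X j `\ k) <= value (v i) (X i).

Definition EF1 (R : realFieldType) (N M : finType)
    (vN : N -> M -> R) (vM : M -> N -> R)
    (XN : N -> {mset M}) (XM : M -> {mset N}) : Prop :=
  EF1_side vN XN /\ EF1_side vM XM.

(* Main.v *)
(** In a two-by-two market, let both agents of [N] value only the partner [true],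
    who in turn values only the agent [true] of [N].  Pairing [true] with [true]
    is then the unique maximum weight matching, so after two rounds the agent
    [false] has value 0 and the agent [true] holds two copies of a partner
    that [false] values at 1: removing one copy does not cure the envy. *)
Require Import Defs.
From mathcomp Require Import all_boot all_order all_algebra.
From mathcomp Require Import finmap multiset.
Import Order.TTheory GRing.Theory Num.Theory.
Local Open Scope ring_scope.

(** Sums over a multiset run over its enumeration; this lets [value_msetn] replace that list by
    [nseq n b]. *)
Lemma perm_msetn (K : choiceType) (n : nat) (b : K) :
  perm_eq (msetn n b) (nseq n b).
Proof.
apply/allP => a _; apply/eqP; rewrite /= count_mem_mset msetnE count_nseq /= eq_sym.
by case: eqP => _; rewrite ?mul1n ?mul0n.
Qed.

Lemma value_msetn (R : realFieldType) (T : finType) (v : T -> R) (n : nat)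
    (b : T) : value v (msetn n b) = v b *+ n.
Proof.
rewrite /value (perm_big _ (perm_msetn _ n b)) big_nseq.
by elim: n => [|n IHn]; rewrite ?mulr0n //= IHn mulrS.
Qed.

Lemma msetnSB1 (K : choiceType) (n : nat) (b : K) :
  (msetn n.+1 b `\ b)%mset = msetn n b.
Proof.
by apply/msetP => a; rewrite msetB1E !msetnE; case: eqP => _; rewrite ?subn1.
Qed.

(** Only positive times are constrained, as [cumul] never reads [p 0]. *)
Lemma cumul_const (T : finType) (p : nat -> {set T}) (b : T) :
  (forall t, (0 < t)%N -> p t = [set b]) -> forall t, cumul p t = msetn t b.
Proof.
move=> pE; elim=> [|t IHt] /=; apply/msetP => a.
  by rewrite msetnE mset0E if_same.
rewrite IHt pE // msetE2 mset_seqE enum_set1 !msetnE /= addn0 [b == a]eq_sym.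
by case: eqP; rewrite ?addn1.
Qed.

Lemma card_set_bool (A : {set bool}) :
  #|A| = ((true \in A) + (false \in A))%N.
Proof. by rewrite -sum1_card big_mkcond big_bool /=; do 2!case: (_ \in A). Qed.

Lemma big_set_bool2 (V : nmodType) (x : {set bool * bool}) (F : bool * bool -> V) :
  \sum_(e in x) F e =
    F (true, true) *+ ((true, true) \in x)
    + F (true, false) *+ ((true, false) \in x)
    + (F (false, true) *+ ((false, true) \in x)
       + F (false, false) *+ ((false, false) \in x)).
Proof.
rewrite big_mkcond /= !mulrb.
(* Writing [p] by its components gives [pair_bigA] a double sum to match. *)
transitivity (\sum_(p : bool * bool)
   (if (p.1, p.2) \in x then F (p.1, p.2) else 0)).
  by apply: eq_bigr => -[].
by rewrite -(pair_bigA _ (fun i j => if (i, j) \in x then F (i, j) else 0))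
  /= !big_bool.
Qed.

Section Counterexample.

Variable R : realFieldType.

Let vN (_ j : bool) : R := j%:R.
Let vM (j i : bool) : R := (j && i)%:R.
Let diag : {set bool * bool} := [set e | e.1 == e.2].

Lemma perfect_diag : perfect_matching diag.
Proof. by split; case; rewrite card_set_bool !inE. Qed.

Lemma max_weight_diag (x : {set bool * bool}) :
  max_weight_matching vN vM x -> x = diag.
Proof.
case=> -[xN xM] /(_ _ perfect_diag); rewrite /weight !big_set_bool2 !inE /=.
move: (xN true) (xN false) (xM true) (xM false).
rewrite !card_set_bool !inE {xN xM}.
(* Of the sixteen edge sets, the degree conditions leave only the diagonal and the antidiagonal. *)
case E1: ((true, true) \in x); case E2: ((true, false) \in x);
case E3: ((false, true) \in x); case E4: ((false, false) \in x) => //= _ _ _ _.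
  by move=> _; apply/setP => -[[] []]; rewrite !inE ?E1 ?E2 ?E3 ?E4.
(* The antidiagonal has edge sum 1 against 2 for [diag], so its maximality would give
   [1 + 1 <= 1]. *)
by rewrite /vN /vM /= ler_pM2l ?invr_gt0 ?ltr0n // !(mulr0n, mulr1n, addr0, add0r)
  gerDl ler10.
Qed.

Lemma partnersN_diag (i : bool) : partnersN diag i = [set i].
Proof. by apply/setP => j; rewrite !inE eq_sym. Qed.

Lemma no_EF1_max_weight :
  ~ (exists x : nat -> {set bool * bool},
       (forall t : nat, (0 < t)%N -> max_weight_matching vN vM (x t)) /\
       (forall t : nat, EF1 vN vM (cumulN x t) (cumulM x t))).
Proof.
(* Round 2 is the earliest that works: after one round, removing the single partner cures any
   envy. *)
case=> x [xmax /(_ 2)[EF1N _]].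
have cumE i t : cumulN x t i = msetn t i.
  apply: cumul_const => s s_gt0.
  by rewrite (max_weight_diag _ (xmax s s_gt0)) partnersN_diag.
have := EF1N false true; rewrite /envies !cumE !value_msetn /vN /=.
case; first by rewrite mul0rn ltr0n.
(* The removed [k] can only be [true], which leaves one copy, of value 1 > 0. *)
move=> k; rewrite in_msetn => /eqP ->.
by rewrite msetnSB1 value_msetn mul0rn mulr1n ler10.
Qed.

End Counterexample.

Theorem theorem4p2 (R : realFieldType) :
  exists (N M : finType) (a : R) (vN : N -> M -> R) (vM : M -> N -> R),
    #|N| = #|M| /\
    0 <= a < 1 /\
    (forall i j, vN i j = a \/ vN i j = 1) /\
    (forall j i, vM j i = a \/ vM j i = 1) /\
    ~ (exists x : nat -> {set N * M},
         (forall t : nat, (0 < t)%N -> max_weight_matching vN vM (x t)) /\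
         (forall t : nat, EF1 vN vM (cumulN x t) (cumulM x t))).
Proof.
(* The low value [a] is 0. *)
exists bool, bool, 0, (fun _ j : bool => j%:R),
  (fun j i : bool => (j && i)%:R).
do 4?split; rewrite ?lexx ?ltr01 //.
- by move=> i []; [right | left].
- by move=> j i; case: (j && i); [right | left].
- exact: no_EF1_max_weight.
Qed.
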